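(* Let $G$ be a finite group, let $\mathcal M\subseteq\mathcal B(\mathcal H)$ be a tracial von Neumann algebra in standard form with faithful normal tracial state $\tau$, let $\varepsilon\ge0$, let $\rho\in\mathcal M^+$ with $\tau(\rho)=1$, and let $\phi:G\to\mathcal U(\mathcal M)$ be an $(\varepsilon,\rho)$-representation. Then there exist an isometry $V:\mathcal H\to\mathcal H\otimes\mathbb C^{|G|}$ such that $VB=(B\otimes I_{|G|})V$ for all $B\in\mathcal M'$, and a unitary representation $\phi':G\to\mathcal M\otimes\mathcal B(\mathbb C^{|G|})$, such that $$\mathbb E_{g\in G}\ \big\|\phi(g)-V^*\phi'(g)V\big\|_\rho^2\le\varepsilon .$$
   Context: $(\mathcal M,\tau)$ in standard form means that $\mathcal M$ acts on the GNS Hilbert space $\mathcal H=L^2(\mathcal M,\tau)$ of the faithful normal tracial state $\tau$ (separable). $\mathcal M'$ is the commutant and $\mathcal U(\mathcal M)$ the unitary group of $\mathcal M$. For $\rho\in\mathcal M^+$ with $\tau(\rho)=1$, the $\rho$-seminorm on $\mathcal M$ is $\|A\|_\rho=\sqrt{\tau(A^*A\rho)}$. $\mathbb E_{g\in G}$ is the uniform average over $G$. A map $\phi:G\to\mathcal U(\mathcal M)$ is an $(\varepsilon,\rho)$-representation if $\phi(g^{-1})=\phi(g)^*$ for all $g\in G$ and $\mathbb E_{g,h\in G}\|\phi(g)\phi(h)-\phi(gh)\|_\rho^2\le\varepsilon$. A unitary representation is a map into unitaries with $\phi'(g)\phi'(h)=\phi'(gh)$ for all $g,h$. *)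

(* Defs.v *)
From HB Require Import structures.
From mathcomp Require Import all_boot all_order all_fingroup all_algebra.
From mathcomp Require Import sesquilinear complex.
From mathcomp Require Import boolp classical_sets functions cardinality reals.
From mathcomp Require Import topology normedtype.

Set Implicit Arguments.
Unset Strict Implicit.
Unset Printing Implicit Defensive.

Import Order.TTheory GRing.Theory Num.Theory.
Import numFieldNormedType.Exports.

Local Open Scope classical_set_scope.
Local Open Scope complex_scope.
Local Open Scope ring_scope.

(* The inner product is linear on the left and conjugate-linear on the right. *)
HB.mixin Record CompleteNormedModule_isHilbert (R : realType) H
    & CompleteNormedModule R[i] H := {
  hdot : {dot H for Num.conj} ;
  hdotE : forall x : H, hdot x x = `|x| ^+ 2
}.

#[short(type="hilbertType")]
HB.structure Definition Hilbert (R : realType) :=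
  {H of CompleteNormedModule R[i] H & CompleteNormedModule_isHilbert R H}.

Section DotNorm.
Variables (C : numClosedFieldType) (U : lmodType C) (form : {dot U for Num.conj}).

Lemma dot_proj (u v : U) (p := u - (form u v / form v v) *: v) : v != 0 ->
  form p p = form u u - `|form u v| ^+ 2 / form v v.
Proof.
move=> v0; have vv0 : 0 < form v v by rewrite dnorm_gt0.
have vvR : (form v v)^* = form v v by apply/CrealP/gtr0_real.
rewrite /p dnormB dnormZ linearZr_LR /= fmorph_div /= vvR.
rewrite normf_div (ger0_norm (ltW vv0)) exprMn !normCK.
set a := form u v; set d := form v v.
have dn0 : d != 0 by rewrite gt_eqF.
have -> : (a^* / d * a)^* = a^* / d * a.
  by rewrite !rmorphM /= conjCK fmorphV /= vvR mulrAC [a * _]mulrC mulrAC.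
have -> : a * a^* * d^-1 ^+ 2 * d = a^* / d * a.
  by rewrite expr2 -!mulrA mulVf // mulr1 mulrCA [d^-1 * a]mulrC.
by rewrite opprD addrA addrK mulrAC [a^* * a]mulrC.
Qed.

Lemma dot_CauchySchwarz (u v : U) : `|form u v| ^+ 2 <= form u u * form v v.
Proof.
have [->|v0] := eqVneq v 0; first by rewrite !linear0r normr0 expr0n /= mulr0.
by rewrite -ler_pdivrMr ?dnorm_gt0 // -subr_ge0 -dot_proj.
Qed.

Lemma dot_triangle (u v : U) :
  sqrtC (form (u + v) (u + v)) <= sqrtC (form u u) + sqrtC (form v v).
Proof.
have s0 w : 0 <= sqrtC (form w w) by rewrite sqrtC_ge0 dnorm_ge0.
rewrite -(ler_pXn2r (n := 2)) ?nnegrE ?addr_ge0 //.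
rewrite sqrtCK dnormD sqrrD !sqrtCK addrAC -addrA -[leRHS]addrA lerD2l.
rewrite [leRHS]addrC [leLHS]addrC lerD2l.
set d := form u v.
have -> : d + d^* = 'Re d *+ 2.
  by rewrite -[_ *+ 2]mulr_natr ReE divfK // pnatr_eq0.
rewrite lerMn2r /=.
apply: le_trans (leif_Re_Creal _) _.
rewrite -(ler_pXn2r (n := 2)) ?nnegrE ?mulr_ge0 //.
by rewrite exprMn !sqrtCK dot_CauchySchwarz.
Qed.

End DotNorm.

(* H (x) C^n, realised as the n-fold Hilbert direct sum of H. *)
Definition htens (R : realType) (H : hilbertType R) (n : nat) : Type :=
  {ffun 'I_n -> H}.

Section HTens.
Variables (R : realType) (H : hilbertType R) (n : nat).
Local Notation C := R[i].
Local Notation HC := (htens H n).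

HB.instance Definition _ := GRing.Lmodule.copy HC {ffun 'I_n -> H}.

Definition htens_dot (x y : HC) : C := \sum_(i < n) hdot (x i) (y i).

Lemma htens_dot_bilinear : bilinear_for *%R (Num.conj \; *%R) htens_dot.
Proof.
split=> [z|z] a x y; rewrite /htens_dot /=.
  rewrite mulr_sumr -big_split /=; apply: eq_bigr => i _.
  by rewrite !ffunE linearPl.
rewrite mulr_sumr -big_split /=; apply: eq_bigr => i _.
by rewrite !ffunE linearPr.
Qed.

HB.instance Definition _ := @bilinear_isBilinear.Build C HC HC C
  *%R (Num.conj \; *%R) htens_dot htens_dot_bilinear.

Lemma htens_dot_herm (x y : HC) :
  htens_dot x y = (-1) ^+ false * (htens_dot y x)^*.
Proof.
rewrite mul1r rmorph_sum; apply: eq_bigr => i _.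
by rewrite hermC /= expr0 mul1r.
Qed.

HB.instance Definition _ := @isHermitianSesquilinear.Build C HC false
  Num.conj htens_dot htens_dot_herm.

Lemma htens_dot_gt0 (x : HC) : x != 0 -> 0 < htens_dot x x.
Proof.
move=> x0; have [i xi0] : exists i, x i != 0.
  apply/existsP; apply: contraNT x0 => /existsPn xi0; apply/eqP/ffunP => i.
  by rewrite ffunE; apply/eqP/negbNE/xi0.
rewrite /htens_dot (bigD1 i) //= ltr_wpDr //; last by rewrite dnorm_gt0.
by apply: sumr_ge0 => j _; apply: dnorm_ge0.
Qed.

HB.instance Definition _ := @isDotProduct.Build C HC htens_dot htens_dot_gt0.

Definition htens_form : {dot HC for Num.conj} := htens_dot.
Definition htens_norm (x : HC) : C := sqrtC (htens_form x x).

Lemma htens_normD (x y : HC) : htens_norm (x + y) <= htens_norm x + htens_norm y.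
Proof. exact: dot_triangle. Qed.

Lemma htens_normZ (a : C) (x : HC) : htens_norm (a *: x) = `|a| * htens_norm x.
Proof.
by rewrite /htens_norm dnormZ rootCMl ?exprn_ge0 // sqrCK.
Qed.

Lemma htens_norm0_eq0 (x : HC) : htens_norm x = 0 -> x = 0.
Proof. by move/eqP; rewrite /htens_norm sqrtC_eq0 dnorm_eq0 => /eqP. Qed.

HB.instance Definition _ :=
  Lmodule_isNormed.Build C HC htens_normD htens_normZ htens_norm0_eq0.

Lemma htens_normE (x : HC) : `|x| = sqrtC (\sum_(i < n) `|x i| ^+ 2).
Proof.
rewrite -[LHS]/(sqrtC (htens_dot x x)); congr (sqrtC _).
by rewrite /htens_dot; apply: eq_bigr => i _; rewrite hdotE.
Qed.

Lemma ler_htens_norm (x : HC) i : `|x i| <= `|x|.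
Proof.
rewrite -(ler_pXn2r (n := 2)) ?nnegrE // htens_normE sqrtCK (bigD1 i) //=.
by rewrite lerDl sumr_ge0 // => j _; rewrite exprn_ge0.
Qed.

Lemma htens_norm_le_sum (x : HC) : `|x| <= \sum_(i < n) `|x i|.
Proof.
have sq (a : 'I_n -> C) (s : seq 'I_n) : (forall i, 0 <= a i) ->
    \sum_(i <- s) a i ^+ 2 <= (\sum_(i <- s) a i) ^+ 2.
  move=> a0; elim: s => [|i s IH]; first by rewrite !big_nil expr0n.
  rewrite !big_cons sqrrD -addrA lerD2l; apply: le_trans IH _.
  by rewrite lerDr mulrn_wge0 // mulr_ge0 // sumr_ge0.
rewrite -(ler_pXn2r (n := 2)) ?nnegrE ?sumr_ge0 // htens_normE sqrtCK.
exact: sq.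
Qed.

Lemma htens_complete (F : set_system HC) : ProperFilter F -> cauchy F -> cvg F.
Proof.
move=> FF /cauchy_ballP Fc.
have cvF i : cvg ((fun x : HC => x i) @ F).
  apply: cauchy_cvg; apply/cauchy_ballP => e e0.
  rewrite near_simpl.
  apply: filterS (Fc e e0) => -[x y] /=; rewrite -!ball_normE /=.
  by apply: le_lt_trans; have := ler_htens_norm (x - y) i; rewrite !ffunE.
apply/cvg_ex; exists [ffun i => lim ((fun x : HC => x i) @ F)].
apply/cvgrPdist_lt => e e0.
have e'0 : 0 < e / n.+1%:R by rewrite divr_gt0.
have near_all : F [set x : HC |
    forall i, `|lim ((fun x : HC => x i) @ F) - x i| < e / n.+1%:R].
  apply: filter_forall => i.
  by have /cvgrPdist_lt/(_ _ e'0) := cvF i.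
apply: filterS near_all => x xi.
apply: le_lt_trans (htens_norm_le_sum _) _.
apply: (@le_lt_trans _ _ (\sum_(i < n) e / n.+1%:R)).
  by apply: ler_sum => i _; rewrite !ffunE; apply/ltW/xi.
rewrite sumr_const card_ord -[ltLHS]mulr_natr -mulrA gtr_pMr // mulrC ltr_pdivrMr //.
by rewrite mul1r ltr_nat.
Qed.

HB.instance Definition _ := Uniform_isComplete.Build HC htens_complete.

Lemma htens_formE (x : HC) : htens_form x x = `|x| ^+ 2.
Proof. by rewrite sqrtCK. Qed.

HB.instance Definition _ := CompleteNormedModule_isHilbert.Build R HC htens_formE.

End HTens.

Section Riesz.
Variables (R : realType) (H : hilbertType R).
Local Notation C := R[i].

Lemma hdot_CS (x y : H) : `|hdot x y| <= `|x| * `|y|.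
Proof.
rewrite -(ler_pXn2r (n := 2)) ?nnegrE ?mulr_ge0 // exprMn -!hdotE.
exact: dot_CauchySchwarz.
Qed.

Lemma hdotC (x y : H) : hdot y x = (hdot x y)^*.
Proof. by rewrite hermC /= expr0 mul1r. Qed.

Definition hsq (x : H) : R := complex.Re (hdot x x).

Lemma hsqE x : (hsq x)%:C = hdot x x.
Proof. by apply: RRe_real; apply: ger0_real; apply: dnorm_ge0. Qed.

Lemma hsq_ge0 x : 0 <= hsq x.
Proof. by rewrite -lecR hsqE dnorm_ge0. Qed.

Lemma hsq_parallelogram x y :
  hsq (x - y) = (hsq x + hsq y) *+ 2 - hsq (x + y).
Proof.
apply: (canRL (addrK _)); apply: complexI.
rewrite rmorphD /= mulr2n !rmorphD /= !hsqE dnormB dnormD.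
by rewrite addrACA addNr addr0.
Qed.

Lemma hsqZ a x : (hsq (a *: x))%:C = `|a| ^+ 2 * (hsq x)%:C.
Proof. by rewrite !hsqE dnormZ. Qed.

Lemma hsq_norm (x : H) : `|x| = (Num.sqrt (hsq x))%:C.
Proof.
apply/eqP; rewrite -(eqrXn2 (n := 2)) //; last by rewrite lecR sqrtr_ge0.
by rewrite -rmorphXn /= sqr_sqrtr ?hsq_ge0 // hsqE hdotE.
Qed.

Lemma hsq_triangle x y :
  Num.sqrt (hsq (x + y)) <= Num.sqrt (hsq x) + Num.sqrt (hsq y).
Proof. by rewrite -lecR rmorphD /= -!hsq_norm ler_normD. Qed.

Lemma riesz (F : H -> C) : linear (F : H -> C^o) -> continuous (F : H -> C^o) ->
  exists z, forall x, F x = hdot x z.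
Proof.
move=> Flin Fcont.
have FZD a x y : F (a *: x + y) = a * F x + F y by exact: Flin.
have F0 : F 0 = 0.
  by have := FZD (-1) 0 0; rewrite scaler0 addr0 mulN1r addNr.
have FZ a x : F (a *: x) = a * F x by rewrite -[a *: x]addr0 FZD F0 addr0.
have FD x y : F (x + y) = F x + F y by have := FZD 1 x y; rewrite scale1r mul1r.
have FB x y : F (x - y) = F x - F y by rewrite FD -scaleN1r FZ mulN1r.
have [[x0 Fx0]|/forallNP F00] := pselect (exists x, F x != 0); last first.
  by exists 0 => x; rewrite linear0r; apply/eqP; apply: contrapT => /negP; exact: F00.
pose E := hsq @` [set x | F x = 1].
have Einf : has_inf E.
  split; last by exists 0 => _ [x _ <-]; apply: hsq_ge0.
  by exists (hsq ((F x0)^-1 *: x0)), ((F x0)^-1 *: x0); rewrite //= FZ mulVf.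
pose D := inf E.
have DE x : F x = 1 -> D <= hsq x.
  by move=> Fx; apply: ge_inf; [case: Einf|exists x].
have DD x y : F x = 1 -> F y = 1 -> D *+ 4 <= hsq (x + y).
  move=> Fx Fy; have := DE (2^-1 *: (x + y)).
  rewrite FZ FD Fx Fy mulVf ?pnatr_eq0 // => /(_ erefl).
  set w := 2^-1 *: _ => Dw.
  have -> : x + y = 2 *: w by rewrite scalerA mulfV ?pnatr_eq0 // scale1r.
  have -> : hsq (2 *: w) = hsq w *+ 4; last by rewrite lerMn2r.
  by apply: complexI; rewrite hsqZ normr_nat -natrX -[RHS]/((_ *+ 4)%:C) rmorphMn mulr_natl.
have DB e x y : F x = 1 -> F y = 1 -> hsq x < D + e -> hsq y < D + e ->
    hsq (x - y) < e *+ 4.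
  move=> Fx Fy xe ye; rewrite hsq_parallelogram ltrBlDr.
  apply: (@lt_le_trans _ _ (((D + e) + (D + e)) *+ 2)).
    by rewrite ltrMn2r /= ltrD.
  by rewrite -mulr2n -mulrnA mulrnDl addrC lerD2l DD.
pose S e := [set x | F x = 1 /\ hsq x < D + e].
pose G := filter_from [set e : R | 0 < e] S.
have GF : ProperFilter G.
  apply: filter_from_proper; first apply: filter_from_filter; first by exists 1 => /=.
    move=> e1 e2 /= e10 e20; exists (Num.min e1 e2) => /=.
      by rewrite lt_min e10.
    move=> x /= [Fx]; rewrite addr_minr lt_min => /andP[x1 x2].
    by split; split.
  move=> e /= e0; have [_ [x Fx <-] xe] := inf_adherent e0 Einf.
  by exists x.
have GC : cvg G.
  apply: cauchy_cvg; apply: cauchy_exP => e e0.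
  have er : e = (complex.Re e)%:C by rewrite RRe_real ?gtr0_real.
  have r0 : 0 < complex.Re e by rewrite -ltcR -er.
  have d0 : 0 < complex.Re e ^+ 2 / 4%:R by rewrite divr_gt0 ?exprn_gt0.
  have [x Gx] : S (complex.Re e ^+ 2 / 4%:R) !=set0.
    have [_ [x Fx <-] xe] := inf_adherent d0 Einf.
    by exists x.
  exists x; exists (complex.Re e ^+ 2 / 4%:R) => //= y [Fy ye].
  case: Gx => Fx xe; rewrite -ball_normE /= hsq_norm er ltcR.
  rewrite -[ltRHS]ger0_norm ?ltW // -sqrtr_sqr ltr_sqrt ?exprn_gt0 //.
  by have := DB _ _ _ Fx Fy xe ye; rewrite -[ltRHS]mulr_natr divfK ?pnatr_eq0.
pose z := lim G.
have Fz : F z = 1.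
  have : (F : H -> C^o) @ G --> (F z : C^o) by apply: continuous_cvg => //; apply: Fcont.
  have : (F : H -> C^o) @ G --> (1 : C^o).
    apply: cvg_near_cst; exists 1 => //= x [].
    by [].
  by move=> /cvg_unique h1 /h1 ->.
have zD : hsq z <= D.
  rewrite leNgt; apply/negP => Dz.
  pose m := (D + hsq z) / 2.
  have [Dm mz] := (midf_lt Dz).
  have D0 : 0 <= D by apply: lb_le_inf; [case: Einf|move=> _ [x _ <-]; apply: hsq_ge0].
  have eta0 : 0 < Num.sqrt (hsq z) - Num.sqrt m.
    by rewrite subr_gt0 ltr_sqrt // (le_lt_trans D0).
  have Gm : G (S (m - D)) by exists (m - D); rewrite //= subr_gt0.
  have /cvgrPdist_lt/(_ ((Num.sqrt (hsq z) - Num.sqrt m)%:C)) : id @ G --> z by exact: GC.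
  rewrite ltcR => /(_ eta0) Gz.
  have [x [[Fx xm] /=]] := filter_ex (filterI Gm Gz).
  rewrite hsq_norm ltcR ltrBrDr => zx.
  have := hsq_triangle (z - x) x; rewrite subrK leNgt => /negP; apply.
  apply: le_lt_trans zx; rewrite lerD2l ler_sqrt ?hsq_ge0 //.
    by apply: ltW; rewrite addrCA subrr addr0 in xm.
  by apply: le_trans D0 (ltW Dm).
have orth w : F w = 0 -> hdot z w = 0.
  move=> Fw; have [->|w0] := eqVneq w 0; first by rewrite linear0r.
  have := DE (z - (hdot z w / hdot w w) *: w).
  rewrite FB FZ Fw mulr0 subr0 => /(_ Fz) /(le_trans zD).
  rewrite -lecR !hsqE dot_proj // lerBrDr gerDl pmulr_lle0 ?invr_gt0 ?dnorm_gt0 //.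
  move=> zw0; have : `|hdot z w| ^+ 2 == 0 by rewrite eq_le zw0 exprn_ge0.
  by rewrite expf_eq0 /= normr_eq0 => /eqP.
have zz : hdot z z != 0.
  rewrite dnorm_eq0; apply: contra_eq_neq Fz => ->.
  by rewrite F0 eq_sym oner_eq0.
exists ((hdot z z)^-1 *: z) => x.
have /orth : F (x - F x *: z) = 0 by rewrite FB FZ Fz mulr1 subrr.
move/(congr1 Num.conj); rewrite rmorph0 -hdotC linearBl linearZl_LR /= => /subr0_eq xz.
rewrite linearZr_LR /= fmorphV /= -hdotC xz mulrCA mulVf ?mulr1 //.
Qed.

End Riesz.

Section Operators.
Variables (R : realType) (H K : hilbertType R).

Definition bounded_op (A : H -> K) : Prop := linear A /\ continuous A.

Definition isometry_op (A : H -> K) : Prop :=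
  linear A /\ forall x, `|A x| = `|x|.

Definition is_adjoint (A : H -> K) (B : K -> H) : Prop :=
  forall x y, hdot (A x) y = hdot x (B y).

(* The default value 0 is irrelevant for bounded operators, see adjP. *)
Definition adj (A : H -> K) : K -> H := xget (fun=> 0) (is_adjoint A).

Lemma is_adjoint_unique (A : H -> K) (B B' : K -> H) :
  is_adjoint A B -> is_adjoint A B' -> B = B'.
Proof.
move=> AB AB'; apply/funext => y; apply/eqP; rewrite -subr_eq0.
rewrite -(dnorm_eq0 (@hdot R H)) linearBr /=.
by rewrite -AB -AB' subrr.
Qed.

Lemma adjP (A : H -> K) : bounded_op A -> is_adjoint A (adj A).
Proof.
move=> [Alin Acont]; apply: xgetPex.
suff /choice[B AB] : forall y, exists z, forall x, hdot (A x) y = hdot x z.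
  by exists B => x y; apply: AB.
move=> y; apply: riesz => [a u v|].
  by rewrite Alin linearPl.
move=> x; apply/cvgrPdist_lt => e e0.
have d0 : 0 < e / (`|y| + 1) by rewrite divr_gt0 // ltr_wpDl.
have /cvgrPdist_lt/(_ _ d0) := Acont x.
apply: filterS => t xt; rewrite -linearBl.
apply: le_lt_trans (hdot_CS _ _) _.
rewrite ltr_pdivlMr ?ltr_wpDl // in xt; apply: le_lt_trans xt.
by rewrite ler_wpM2l // lerDl.
Qed.

Lemma adj_eq (A : H -> K) (B : K -> H) :
  bounded_op A -> is_adjoint A B -> adj A = B.
Proof. by move=> /adjP; apply: is_adjoint_unique. Qed.

End Operators.

Section VonNeumann.
Variables (R : realType) (H : hilbertType R).
Local Notation C := R[i].
Implicit Types (M S D : set (H -> H)) (A B T : H -> H) (tau : (H -> H) -> C).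

Definition commutant S : set (H -> H) :=
  [set B | bounded_op B /\ forall A, S A -> A \o B = B \o A].

(* Being a unital subalgebra follows from being a bicommutant. *)
Definition von_neumann_algebra M : Prop :=
  [/\ forall A, M A -> bounded_op A,
      forall A, M A -> M (adj A) &
      commutant (commutant M) = M].

Definition unitary_op A : Prop :=
  [/\ bounded_op A, adj A \o A = id & A \o adj A = id].

Definition positive_op A : Prop := forall x, 0 <= hdot (A x) x.

Definition op_le A B : Prop := positive_op (B - A).

Definition directed_ops D : Prop :=
  D !=set0 /\
  forall A B, D A -> D B -> exists T, [/\ D T, op_le A T & op_le B T].

Definition op_sup_in M D T : Prop :=
  [/\ M T, forall A, D A -> op_le A T &
      forall B, M B -> (forall A, D A -> op_le A B) -> op_le T B].

Definition is_state M tau : Prop :=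
  [/\ forall (a : C) A B, M A -> M B -> tau (a *: A + B) = a * tau A + tau B,
      forall A, M A -> positive_op A -> 0 <= tau A &
      tau id = 1].

Definition is_faithful M tau : Prop :=
  forall A, M A -> positive_op A -> tau A = 0 -> A = 0.

Definition is_tracial M tau : Prop :=
  forall A B, M A -> M B -> tau (A \o B) = tau (B \o A).

(* tau preserves suprema of bounded increasing nets of positive elements. *)
Definition is_normal M tau : Prop :=
  forall D T, (forall A, D A -> M A /\ positive_op A) ->
    directed_ops D -> op_sup_in M D T -> supremums (tau @` D) (tau T).

(* L identifies H with the completion of M for <A, B> = tau(B^* A), on which
   M acts by left multiplication. *)
Definition standard_form M tau : Prop :=
  exists L : (H -> H) -> H,
    [/\ forall (a : C) A B, M A -> M B -> L (a *: A + B) = a *: L A + L B,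
        forall A B, M A -> M B -> hdot (L A) (L B) = tau (adj B \o A),
        dense (L @` M) &
        forall A B, M A -> M B -> A (L B) = L (A \o B)].

Definition separable : Prop := exists S : set H, countable S /\ dense S.

Definition rho_norm tau (rho : H -> H) A : C := sqrtC (tau (adj A \o A \o rho)).

Definition tensor_op A n (T : 'M[C]_n) : htens H n -> htens H n :=
  fun x => [ffun i => \sum_j T i j *: A (x j)].

(* Finite sums of elementary tensors: C^n being finite-dimensional, no closure
   is needed. *)
Definition tensor_matrix_algebra M n : set (htens H n -> htens H n) :=
  [set X | exists k (A : 'I_k -> H -> H) (T : 'I_k -> 'M[C]_n),
    (forall i, M (A i)) /\ X = \sum_i tensor_op (A i) (T i)].

End VonNeumann.

Arguments separable {R} H.

Definition avg (F : fieldType) (T : finType) (f : T -> F) : F :=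
  (\sum_x f x) / #|T|%:R.

Definition approx_rep (R : realType) (H : hilbertType R) (G : finGroupType)
    (tau : (H -> H) -> R[i]) (rho : H -> H) (eps : R) (phi : G -> H -> H) :
    Prop :=
  (forall g, phi g^-1%g = adj (phi g)) /\
  avg (fun gh : G * G =>
    rho_norm tau rho (phi gh.1 \o phi gh.2 - phi (gh.1 * gh.2)%g) ^+ 2)
    <= eps%:C.

(* Main.v *)
(* The Gowers-Hatami averaging argument.  Put
   V x = |G|^(-1/2) sum_h phi(h) x (x) e_h and let phi' be the right regular
   representation of G on C^|G|.  Then V^* phi'(g) V is the average over h of
   phi(h)^* phi(h g), hence phi(g) - V^* phi'(g) V is the average over h of
   phi(h)^* (phi(h) phi(g) - phi(h g)).  The square of the rho-seminorm is
   convex and invariant under left multiplication by unitaries, so averaging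
   over g gives the bound by eps. *)
Require Import Defs.
From HB Require Import structures.
From mathcomp Require Import all_boot all_order all_fingroup all_algebra.
From mathcomp Require Import sesquilinear complex.
From mathcomp Require Import boolp classical_sets functions cardinality reals.
From mathcomp Require Import topology normedtype.

Set Implicit Arguments.
Unset Strict Implicit.
Unset Printing Implicit Defensive.

Import Order.TTheory GRing.Theory Num.Theory.
Import numFieldNormedType.Exports.

Local Open Scope classical_set_scope.
Local Open Scope complex_scope.
Local Open Scope ring_scope.

(** * Bounded operators and their adjoints *)

Lemma linear_apply_scale (K : pzRingType) (U V : lmodType K) (A : U -> V) a x :
  linear A -> A (a *: x) = a *: A x.
Proof.
move=> Alin; have A0 : A 0 = 0.
  by have := Alin (-1) 0 0; rewrite scaler0 addr0 scaleN1r addNr.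
by have := Alin a x 0; rewrite A0 !addr0.
Qed.

Section BoundedOperators.
Variable R : realType.
Local Notation C := R[i].

Lemma bounded_id (H : hilbertType R) : bounded_op (id : H -> H).
Proof. by split=> // x; apply: cvg_id. Qed.

Lemma bounded_comp (H K L : hilbertType R) (A : K -> L) (B : H -> K) :
  bounded_op A -> bounded_op B -> bounded_op (A \o B).
Proof.
move=> [Alin Ac] [Blin Bc]; split=> [a x y|x] /=; first by rewrite Blin Alin.
by apply: continuous_comp; [apply: Bc|apply: Ac].
Qed.

Lemma bounded_lincomb (H K : hilbertType R) (a : C) (A B : H -> K) :
  bounded_op A -> bounded_op B -> bounded_op (a *: A + B).
Proof.
move=> [Alin Ac] [Blin Bc]; split=> [b x y|x].
  rewrite !fctE Alin Blin !scalerDr !scalerA [b * a]mulrC.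
  by rewrite !addrA; congr (_ + _); rewrite addrAC.
by apply: cvgD; [apply: cvgZl_tmp; apply: Ac|apply: Bc].
Qed.

(** Makes [adjP] and [adj_eq] available for [V] and [phi'], which are first seen to preserve
    norms. *)
Lemma bounded_isometry (H K : hilbertType R) (A : H -> K) :
  isometry_op A -> bounded_op A.
Proof.
move=> [Alin An]; split=> // x; apply/cvgrPdist_lt => e e0.
near=> t.
have -> : A x - A t = A (x - t).
  by rewrite [x - t]addrC -[- t]scaleN1r Alin scaleN1r addrC.
rewrite An; near: t.
by move: e e0; apply/cvgrPdist_lt; apply: cvg_id.
Unshelve. all: by end_near. Qed.

Lemma adj_comp (H : hilbertType R) (A B : H -> H) :
  bounded_op A -> bounded_op B -> adj (A \o B) = adj B \o adj A.
Proof.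
move=> Ab Bb; apply: adj_eq; first exact: bounded_comp.
by move=> x y /=; rewrite adjP // adjP.
Qed.

Lemma adj_lincomb (H : hilbertType R) (a : C) (A B : H -> H) :
  bounded_op A -> bounded_op B -> adj (a *: A + B) = a^* *: adj A + adj B.
Proof.
move=> Ab Bb; apply: adj_eq; first exact: bounded_lincomb.
by move=> x y; rewrite !fctE linearPl linearDr linearZr_LR /= conjCK !adjP.
Qed.

(** [adj_eq] is applied to [adj A] and so asks that it be bounded; for elements of a von Neumann
    algebra, closure under adjoints supplies this. *)
Lemma adjK (H : hilbertType R) (A : H -> H) :
  bounded_op A -> bounded_op (adj A) -> adj (adj A) = A.
Proof.
move=> Ab A'b; apply: adj_eq => // x y.
by rewrite hdotC -adjP // -hdotC.
Qed.

End BoundedOperators.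

(** * Closure properties of a von Neumann algebra *)

Section TracialAlgebra.
Variables (R : realType) (H : hilbertType R) (M : set (H -> H)).
Variables (tau : (H -> H) -> R[i]) (rho : H -> H).
Hypothesis M_vN : von_neumann_algebra M.
Local Notation C := R[i].

Lemma vN_bounded A : M A -> bounded_op A.
Proof. by case: M_vN => Mb _ _ /Mb. Qed.

Lemma vN_adj A : M A -> M (adj A).
Proof. by case: M_vN => _ Ma _ /Ma. Qed.

(** Once [M] is rewritten as its bicommutant, only boundedness and commutation with [commutant M]
    remain; products and linear combinations are treated the same way. *)
Lemma vN_id : M id.
Proof. by case: M_vN => _ _ <-; split=> //; apply: bounded_id. Qed.

Lemma vN_comp A B : M A -> M B -> M (A \o B).
Proof.
case: M_vN => _ _ <- [Ab Ac] [Bb Bc]; split; first exact: bounded_comp.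
by move=> T TM; rewrite compA Ac // -compA Bc.
Qed.

Lemma vN_lincomb a A B : M A -> M B -> M (a *: A + B).
Proof.
case: M_vN => _ _ <- [Ab Ac] [Bb Bc]; split; first exact: bounded_lincomb.
move=> T TM; have [[Tlin _] _] := TM; apply/funext => x.
have /(congr1 (@^~ x)) /= e1 := Ac _ TM; have /(congr1 (@^~ x)) /= e2 := Bc _ TM.
by rewrite /= !fctE Tlin e1 e2.
Qed.

Lemma vN_zero : M 0.
Proof. by have := vN_lincomb (-1) vN_id vN_id; rewrite scaleN1r addNr. Qed.

Lemma vN_scale a A : M A -> M (a *: A).
Proof. by move=> MA; rewrite -[_ *: _]addr0; apply/vN_lincomb/vN_zero. Qed.

Lemma vN_sub A B : M A -> M B -> M (A - B).
Proof. by move=> MA MB; rewrite addrC -scaleN1r; apply: vN_lincomb. Qed.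

Lemma vN_sum (I : Type) (r : seq I) (A : I -> H -> H) :
  (forall i, M (A i)) -> M (\sum_(i <- r) A i).
Proof.
move=> MA; apply: big_ind => //; first exact: vN_zero.
by move=> B D MB MD; rewrite -[B]scale1r; apply: vN_lincomb.
Qed.

(** * The rho-seminorm and its semi-inner product *)

Hypothesis tau_state : is_state M tau.
Hypothesis tau_tracial : is_tracial M tau.
Hypotheses (rho_M : M rho) (rho_pos : positive_op rho).

(** Polarising the squared rho-seminorm lets convexity be proved by expansion. The conjugate-linear
    argument is the left one, opposite to [hdot]. *)
Definition rho_form (A B : H -> H) : C := tau (adj A \o B \o rho).

Lemma rho_formE A : rho_norm tau rho A ^+ 2 = rho_form A A.
Proof. by rewrite /rho_norm sqrtCK. Qed.

Lemma rho_form_mem A B : M A -> M B -> M (adj A \o B \o rho).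
Proof. by move=> MA MB; apply: vN_comp rho_M; apply: vN_comp MB; apply: vN_adj. Qed.

Lemma rho_form_lincombr a A B D : M A -> M B -> M D ->
  rho_form A (a *: B + D) = a * rho_form A B + rho_form A D.
Proof.
move=> MA MB MD; have [tau_lin _ _] := tau_state.
rewrite /rho_form -tau_lin; try exact: rho_form_mem.
congr tau; apply/funext => x; rewrite !fctE /=.
by have [-> _] := vN_bounded (vN_adj MA).
Qed.

Lemma rho_form_lincombl a A B D : M A -> M B -> M D ->
  rho_form (a *: B + D) A = a^* * rho_form B A + rho_form D A.
Proof.
move=> MA MB MD; have [tau_lin _ _] := tau_state.
rewrite /rho_form -tau_lin; try exact: rho_form_mem.
by congr tau; rewrite adj_lincomb //; apply: vN_bounded.
Qed.

(* By traciality tau (A^* A rho) = tau (A rho A^* ), and A rho A^* is positive: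
   no square root of rho is needed. *)
Lemma rho_form_ge0 A : M A -> 0 <= rho_form A A.
Proof.
move=> MA; have [_ tau_pos _] := tau_state.
have MA' := vN_adj MA.
rewrite /rho_form -compA tau_tracial //; last exact: vN_comp.
apply: tau_pos; first exact: vN_comp (vN_comp MA rho_M) MA'.
by move=> x /=; rewrite adjP ?rho_pos //; apply: vN_bounded.
Qed.

Lemma rho_form_suml (I : Type) (r : seq I) (A : I -> H -> H) B :
  (forall i, M (A i)) -> M B ->
  rho_form (\sum_(i <- r) A i) B = \sum_(i <- r) rho_form (A i) B.
Proof.
move=> MA MB; elim: r => [|i r IH].
  (* The empty sum is written as -id + id, so the form vanishes on it by linearity. *)
  have := rho_form_lincombl (-1) MB vN_id vN_id.
  by rewrite !big_nil scaleN1r addNr rmorphN1 mulN1r addNr.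
rewrite !big_cons -IH -[A i in LHS]scale1r.
by rewrite rho_form_lincombl ?rmorph1 ?mul1r //; apply: vN_sum.
Qed.

Lemma rho_form_sumr (I : Type) (r : seq I) (A : I -> H -> H) B :
  (forall i, M (A i)) -> M B ->
  rho_form B (\sum_(i <- r) A i) = \sum_(i <- r) rho_form B (A i).
Proof.
move=> MA MB; elim: r => [|i r IH].
  have := rho_form_lincombr (-1) MB vN_id vN_id.
  by rewrite !big_nil scaleN1r addNr mulN1r addNr.
rewrite !big_cons -IH -[A i in LHS]scale1r.
by rewrite rho_form_lincombr ?mul1r //; apply: vN_sum.
Qed.

(* The difference of the two sides is the average of
   rho_form (A i - B) (A i - B). *)
Lemma rho_form_avg_le (I : finType) (A : I -> H -> H)
    (B := #|I|%:R^-1 *: \sum_i A i) :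
  (0 < #|I|)%N -> (forall i, M (A i)) ->
  rho_form B B <= avg (fun i => rho_form (A i) (A i)).
Proof.
move=> I0 MA; have MS : M (\sum_i A i) by apply: vN_sum.
have MB : M B by apply: vN_scale.
have n0 : 0 < #|I|%:R :> C by rewrite ltr0n.
have SE : \sum_i A i = #|I|%:R *: B by rewrite scalerA mulfV ?gt_eqF // scale1r.
rewrite /avg ler_pdivlMr // -subr_ge0.
suff -> : \sum_i rho_form (A i) (A i) - rho_form B B * #|I|%:R =
    \sum_i rho_form (A i - B) (A i - B).
  by apply: sumr_ge0 => i _; apply/rho_form_ge0/vN_sub.
(* The sum n B is split as (n - 1) B + B to fit the shape of the linearity lemmas. *)
have SE1 : \sum_i A i = (#|I|%:R - 1) *: B + B.
  by rewrite scalerBl scale1r subrK SE.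
have formSl : rho_form (\sum_i A i) B = #|I|%:R * rho_form B B.
  rewrite SE1 rho_form_lincombl // rmorphB /= rmorph_nat rmorph1.
  by rewrite mulrBl mul1r subrK.
have formSr : rho_form B (\sum_i A i) = #|I|%:R * rho_form B B.
  by rewrite SE1 rho_form_lincombr // mulrBl mul1r subrK.
(* The grouping makes the last bracket sum to zero, because the sum of the forms of [A i] and [B] is
   n times the form of [B] with itself; the other cross term leaves the required n copies. *)
rewrite [RHS](eq_bigr (fun i => rho_form (A i) (A i) - rho_form B (A i) -
    (rho_form (A i) B - rho_form B B))); last first.
  move=> i _; have MAB := vN_sub (MA i) MB.
  rewrite [A i - B]addrC -[- B]scaleN1r in MAB *.
  rewrite rho_form_lincombr // !rho_form_lincombl // rmorphN1 !mulN1r.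
  by rewrite addrC [- _ + _]addrC [- rho_form B B + _]addrC.
rewrite !sumrB -rho_form_sumr // -rho_form_suml // formSl formSr.
by rewrite sumr_const -[rho_form B B *+ _]mulr_natl subrr subr0 [rho_form _ _ * _]mulrC.
Qed.

(** The unitary factors meet in the middle: (U^* A)^* U^* A = A^* U U^* A = A^* A. *)
Lemma rho_form_unitary U A : M U -> unitary_op U -> M A ->
  rho_form (adj U \o A) (adj U \o A) = rho_form A A.
Proof.
move=> MU [Ub _ UU'] MA; have MU' := vN_adj MU.
rewrite /rho_form adj_comp ?adjK //; try exact: vN_bounded.
by rewrite -[(adj A \o U) \o _]compA [U \o _]compA UU'.
Qed.

End TracialAlgebra.

(** * Dilation of the approximate representation *)

Theorem theorem5p1 (R : realType) (G : finGroupType) (H : hilbertType R)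
    (M : set (H -> H)) (tau : (H -> H) -> R[i])
    (eps : R) (rho : H -> H) (phi : G -> H -> H)
    (M_vN : von_neumann_algebra M)
    (tau_state : is_state M tau)
    (tau_faithful : is_faithful M tau)
    (tau_normal : is_normal M tau)
    (tau_tracial : is_tracial M tau)
    (M_std : standard_form M tau)
    (H_sep : separable H)
    (eps_ge0 : 0 <= eps)
    (rho_M : M rho) (rho_pos : positive_op rho) (rho_1 : tau rho = 1)
    (phi_M : forall g, M (phi g)) (phi_unitary : forall g, unitary_op (phi g))
    (phi_rep : approx_rep tau rho eps phi) :
  exists (V : H -> htens H #|G|) (phi' : G -> htens H #|G| -> htens H #|G|),
    [/\ isometry_op V,
        forall B, commutant M B -> V \o B = tensor_op B 1%:M \o V,
        forall g, tensor_matrix_algebra M (phi' g) /\ unitary_op (phi' g),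
        forall g h, phi' g \o phi' h = phi' (g * h)%g &
        avg (fun g => rho_norm tau rho (phi g - (adj V \o phi' g \o V)) ^+ 2)
          <= eps%:C].
Proof.
set n := #|G|.
have n0 : (0 < n)%N by apply/card_gt0P; exists 1%g.
pose c : R[i] := (sqrtC n%:R)^-1.
pose V x : htens H n := [ffun i => c *: phi (enum_val i) x].
(* Coordinates are indexed by group elements through [enum_val]. Coordinate k of phi'(g) phi'(h) y
   is coordinate k g h of y, so right translation respects the order of products. *)
pose phi' (g : G) (y : htens H n) : htens H n :=
  [ffun i => y (enum_rank (enum_val i * g)%g)].
have phi_b g : bounded_op (phi g) by case: (phi_unitary g).
have c0 : 0 <= c by rewrite invr_ge0 sqrtC_ge0 ler0n.
have cc : c ^+ 2 = n%:R^-1 by rewrite exprVn sqrtCK.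
have phi_dot g x y : hdot (phi g x) (phi g y) = hdot x y.
  by have [_ /(congr1 (@^~ y)) /= e _] := phi_unitary g; rewrite adjP // e.
have V_dot x y : hdot (V x) (V y) = hdot x y.
  rewrite -[LHS]/(\sum_(i < n) _).
  under eq_bigr => i _.
    rewrite !ffunE linearZl_LR linearZr_LR /= phi_dot (geC0_conj c0).
    rewrite mulrA -expr2 cc; over.
  rewrite sumr_const card_ord -[(_ * _) *+ _]mulr_natl mulrA.
  by rewrite mulfV ?mul1r // pnatr_eq0 -lt0n.
have V_isom : isometry_op V.
  split=> [a x y|x].
    apply/ffunP => i; rewrite !ffunE; have [-> _] := phi_b (enum_val i).
    by rewrite scalerDr !scalerA mulrC.
  by apply/eqP; rewrite -(eqrXn2 (n := 2)) // -!hdotE V_dot.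
have phi'M g h : phi' g \o phi' h = phi' (g * h)%g.
  by apply/funext => y; apply/ffunP => i; rewrite !ffunE enum_rankK mulgA.
have phi'1 : phi' 1%g = id.
  by apply/funext => y; apply/ffunP => i; rewrite !ffunE mulg1 enum_valK.
have phi'_dot g x y : hdot (phi' g x) (phi' g y) = hdot x y.
  rewrite -[LHS]/(\sum_(i < n) _) -[RHS]/(\sum_(i < n) _).
  rewrite [RHS](reindex (fun i : 'I_n => enum_rank (enum_val i * g)%g)) /=.
    by apply: eq_bigr => i _; rewrite !ffunE.
  exists (fun i : 'I_n => enum_rank (enum_val i * g^-1)%g) => i _.
    by rewrite enum_rankK mulgK enum_valK.
  by rewrite enum_rankK mulgKV enum_valK.
have phi'_b g : bounded_op (phi' g).
  apply: bounded_isometry; split=> [a x y|x].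
    by apply/ffunP => i; rewrite !ffunE.
  by apply/eqP; rewrite -(eqrXn2 (n := 2)) // -!hdotE phi'_dot.
have phi'_adj g : adj (phi' g) = phi' g^-1%g.
  (* Applying phi'(g) to both arguments of the right-hand pairing turns its second argument into
     y. *)
  apply: adj_eq => // x y; rewrite -[RHS](phi'_dot g).
  by rewrite -[phi' g (phi' _ y)]/((phi' g \o phi' _) y) phi'M mulgV phi'1.
exists V, phi'; split=> //.
- move=> B [[Blin _] BM]; apply/funext => x; apply/ffunP => i; rewrite !ffunE.
  rewrite (bigD1 i) //= big1 ?addr0; last first.
    by move=> j ji; rewrite mxE eq_sym (negPf ji) scale0r.
  rewrite mxE eqxx scale1r ffunE linear_apply_scale //.
  (* Each coordinate of [V] is a scalar times an element of [M], hence commutes with [B]. *)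
  by have /(congr1 (@^~ x)) /= -> := BM _ (phi_M (enum_val i)).
- move=> g; split.
    (* A single elementary tensor suffices: the identity of [M] with the permutation matrix having a
       1 at each entry (k, k g). *)
    exists 1%N, (fun=> id).
    exists (fun=> \matrix_(i, j) (j == enum_rank (enum_val i * g)%g)%:R).
    split=> [_|]; first exact: vN_id.
    rewrite big_ord1; apply/funext => y; apply/ffunP => i; rewrite !ffunE.
    rewrite (bigD1 (enum_rank (enum_val i * g)%g)) //= big1 ?addr0.
      by rewrite mxE eqxx scale1r.
    by move=> j ji; rewrite mxE (negPf ji) scale0r.
  by split=> //; rewrite phi'_adj phi'M ?mulVg ?mulgV phi'1.
have phi_adj_M g : M (adj (phi g)) by apply: vN_adj.
(* The multiplicativity defect, with h on the left: for fixed g, it is h that gets averaged. *)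
pose E g h := phi h \o phi g - phi (h * g)%g.
have EM g h : M (E g h) by apply: vN_sub => //; apply: vN_comp.
have defect g : phi g - (adj V \o phi' g \o V) =
    n%:R^-1 *: \sum_h (adj (phi h) \o E g h).
  (* The scalar [c] is real, so it reappears unconjugated in the adjoint. *)
  have adjV : adj V = fun y => \sum_i c *: adj (phi (enum_val i)) (y i).
    apply: adj_eq; first exact: bounded_isometry.
    move=> x y; rewrite linear_sumr -[LHS]/(\sum_(i < n) _).
    apply: eq_bigr => i _.
    by rewrite ffunE linearZl_LR linearZr_LR /= adjP // (geC0_conj c0).
  apply/funext => x; rewrite adjV !fctE fct_sumE.
  under [in RHS]eq_bigr => h _.
    have [adj_lin _] := vN_bounded M_vN (phi_adj_M h).
    (* Here phi(h)^* phi(h) = id; the resulting term phi(g) x is independent of h, so averaging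
       leaves it unchanged. *)
    have -> : (adj (phi h) \o E g h) x = phi g x - adj (phi h) (phi (h * g)%g x).
      have [_ /(congr1 (@^~ (phi g x))) /= e _] := phi_unitary h.
      by rewrite /= /E !fctE /= addrC -scaleN1r adj_lin scaleN1r e addrC.
    over.
  rewrite sumrB scalerBr sumr_const -[phi g x *+ _]scaler_nat scalerA.
  rewrite mulVf ?pnatr_eq0 -?lt0n // scale1r; congr (_ - _).
  rewrite (reindex (fun h : G => enum_rank h)) /=; last exact/onW_bij/enum_rank_bij.
  rewrite scaler_sumr; apply: eq_bigr => h _.
  have [adj_lin _] := vN_bounded M_vN (phi_adj_M h).
  rewrite !ffunE !enum_rankK linear_apply_scale //.
  (* One factor [c] comes from [V] and one from its adjoint; together they give 1/n. *)
  by rewrite scalerA -expr2 cc.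
have [_ phi_le] := phi_rep; apply: le_trans phi_le; rewrite /avg.
under eq_bigr do rewrite rho_formE defect.
under [X in _ <= X / _]eq_bigr do rewrite rho_formE.
(* The average over pairs carries 1/n twice; one factor cancels the average over g, the other serves
   the average over h. *)
rewrite card_prod natrM invfM mulrA ler_pM2r ?invr_gt0 ?ltr0n //.
(* A pair is read as (h, g). Exchanging the sums puts g outside, so the bound can be proved for each
   g: convexity first, then unitary invariance for each h. *)
rewrite -(pair_bigA _ (fun h g => rho_form tau rho (E g h) (E g h))) /=.
rewrite exchange_big mulr_suml /=; apply: ler_sum => g _.
have avg_le := rho_form_avg_le M_vN tau_state tau_tracial rho_M rho_pos n0.
apply: le_trans (avg_le _ (fun h => vN_comp M_vN (phi_adj_M h) (EM g h))) _.
apply: ler_wpM2r; first by rewrite invr_ge0 ler0n.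
by apply: ler_sum => h _; rewrite (rho_form_unitary _ _ M_vN).
Qed.
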